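(* Let $n\ge1$ and $\gamma\in PSL(n+1,\mathbb{C})$. Then $\gamma$ is loxodromic if and only if there is a nonempty open set $W\subsetneq\mathbb{P}^n_{\mathbb{C}}$ such that $\gamma(\overline W)\subset W$.
   Context: $\gamma\in PSL(n+1,\mathbb{C})=GL(n+1,\mathbb{C})/\mathbb{C}^*$, acting on $\mathbb{P}^n_{\mathbb{C}}$, is called loxodromic if every lift $\widetilde\gamma\in SL(n+1,\mathbb{C})$ of $\gamma$ has an eigenvalue of modulus different from $1$. *)

(* Defs.v *)
From HB Require Import structures.
From mathcomp Require Import all_boot all_order all_algebra.
From mathcomp Require Import all_classical all_reals all_analysis.
From mathcomp Require Import complex.
Import numFieldNormedType.Exports numFieldTopology.Exports.
Import Order.TTheory GRing.Theory Num.Theory.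

Set Implicit Arguments.
Unset Strict Implicit.
Unset Printing Implicit Defensive.

Local Open Scope ring_scope.
Local Open Scope classical_set_scope.
Local Open Scope quotient_scope.

(* The complex numbers: C = R[i] for a realType R (any realType is a model of
   the real numbers), with its usual (norm) topology. *)
HB.instance Definition _ (R : realType) :=
  PseudoPointedMetric.copy R[i] (Num.ClosedField.sort R[i]).

(* C^{n+1} \ {0}, with the subspace topology of C^{n+1} (row vectors). *)
Definition nonzero_vec (R : realType) (n : nat) : set 'rV[R[i]]_(n.+1) :=
  [set v | v != 0].
Definition punctured (R : realType) (n : nat) := set_type (@nonzero_vec R n).

Definition proportional (R : realType) (n : nat) (u v : punctured R n) : bool :=
  `[< exists c : R[i], c != 0 /\ set_val u = c *: set_val v >].

Lemma proportional_refl R n : reflexive (@proportional R n).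
Proof. by move=> u; apply/asboolP; exists 1; rewrite oner_neq0 scale1r. Qed.

Lemma proportional_sym R n : symmetric (@proportional R n).
Proof.
suff H : forall u v, @proportional R n u v -> @proportional R n v u.
  by move=> u v; apply/idP/idP; apply: H.
rewrite /proportional => u v /asboolP [c [c0 huv]]; apply/asboolP.
by exists c^-1; rewrite invr_eq0 c0 huv scalerA mulVf // scale1r.
Qed.

Lemma proportional_trans R n : transitive (@proportional R n).
Proof.
rewrite /proportional => v u w /asboolP [c [c0 huv]] /asboolP [d [d0 hvw]].
apply/asboolP; exists (c * d); rewrite mulf_neq0 //; split => //.
by rewrite huv hvw scalerA.
Qed.

Definition proportional_equiv R n : equiv_rel (punctured R n) :=
  EquivRel (@proportional R n) (@proportional_refl R n)
    (@proportional_sym R n) (@proportional_trans R n).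

Definition projective_space (R : realType) (n : nat) :=
  quotient_topology {eq_quot (@proportional_equiv R n)}.

(* A default nonzero vector (only used to make the action total). *)
Definition one_vec (R : realType) (n : nat) : 'rV[R[i]]_(n.+1) := const_mx 1.

Lemma one_vec_neq0 R n : @one_vec R n \in @nonzero_vec R n.
Proof.
rewrite inE /nonzero_vec /=; apply/eqP => /matrixP /(_ 0 0).
by rewrite !mxE; apply/eqP; exact: oner_neq0.
Qed.

(* Action of the class of A in PGL(n+1,C) = GL(n+1,C)/C^* on P^n:
   [v] |-> [v A] (row vectors; A is assumed invertible, so v A != 0). *)
Definition proj_act (R : realType) (n : nat) (A : 'M[R[i]]_(n.+1))
    (x : projective_space R n) : projective_space R n :=
  \pi_({eq_quot (@proportional_equiv R n)})
    (insubd (exist _ (@one_vec R n) (@one_vec_neq0 R n) : punctured R n)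
       (set_val (repr x) *m A)).

(* gamma = [A] is loxodromic iff every lift of gamma to SL(n+1,C), i.e.
   every c A (c in C) with det (c A) = 1, has an eigenvalue of modulus != 1. *)
Definition loxodromic (R : realType) (n : nat) (A : 'M[R[i]]_(n.+1)) : Prop :=
  forall c : R[i], \det (c *: A) = 1 ->
    exists lambda : R[i], eigenvalue (c *: A) lambda /\ `|lambda| != 1.

(* Main.v *)
Require Import Defs.
From HB Require Import structures.
From mathcomp Require Import all_boot all_order all_algebra.
From mathcomp Require Import all_classical all_reals all_analysis.
From mathcomp Require Import complex ring lra.
Import numFieldNormedType.Exports numFieldTopology.Exports.
Import Order.TTheory GRing.Theory Num.Theory.
Local Open Scope ring_scope.
Local Open Scope classical_set_scope.

(** Everything is read on the cones over [W] and over its closure in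
    [C^(n+1) \ 0].  That [A] maps the closed cone [C] into the open cone [V] is
    an open condition on [A], by compactness of the unit sphere, and it is
    invariant under rescaling and, after changing the cones, under conjugation.

    If all eigenvalues of [A] have modulus 1, triangularise [A] and perturb its
    diagonal to distinct numbers of modulus 1: some unitary diagonal matrix [D]
    maps such a [C] into [V].  Since [C^(n+1) \ 0] is connected there is a point
    [x] of [C] outside [V]; then [x D^-1] is outside the closed set [C], but by
    recurrence it is a limit of points [x D^m] with [m >= 0], which are in [C].

    If the eigenvalues [d i] of [A] do not all have the same modulus, let [r] be
    one of these moduli but not the largest.  The diagonal matrix with entries
    [d i] admits the cones [h > 0] and [h >= 0], where [h v] is the sum of the
    [|v i|] with [|d i| > r] minus the sum of the others, and [A] is conjugate
    to matrices arbitrarily close to this diagonal matrix. *)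

Set Implicit Arguments.
Unset Strict Implicit.
Unset Printing Implicit Defensive.

(** Makes [R[i]] a normed space over itself, so that limit rules for normed modules apply to complex
    sums and products. *)
HB.instance Definition _ (R : realType) :=
  NormedModule.copy R[i] (Num.ClosedField.sort R[i])^o.
Local Notation normc := (@ComplexField.Normc.normc _).

(** * Entrywise limits of matrices *)

Lemma cvg_mx (K : numFieldType) m n (T : Type) (F : set_system T)
    {FF : Filter F} (f : T -> 'M[K]_(m, n)) (M : 'M[K]_(m, n)) :
  (forall i j, f t i j @[t --> F] --> M i j) -> f @ F --> M.
Proof.
move=> fM A [P MP PA].
have : \forall t \near F, forall i j, P i j (f t i j).
  by apply: filter_forall => i; apply: filter_forall => j; exact: fM (MP i j).
by apply: filterS => t Pt; exact: PA.
Qed.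

Lemma cvg_mx_coord (K : numFieldType) m n (T : Type) (F : set_system T)
    {FF : Filter F} (f : T -> 'M[K]_(m, n)) (M : 'M[K]_(m, n)) i j :
  f @ F --> M -> f t i j @[t --> F] --> M i j.
Proof.
move=> fM; apply: (@cvg_comp _ _ _ f (fun M => M i j) F _ _ fM).
exact: coord_continuous.
Qed.

Lemma cvg_sum (K : numFieldType) (V : normedModType K) (I T : Type)
    (F : set_system T) {FF : Filter F} (r : seq I) (f : I -> T -> V) (a : I -> V) :
  (forall i, f i @ F --> a i) ->
  \sum_(i <- r) f i t @[t --> F] --> \sum_(i <- r) a i.
Proof.
by move=> fa; apply: cvg_big => //; exact: add_continuous.
Qed.

Lemma cvg_mulmx (K : numFieldType) m n p (T : Type) (F : set_system T)
    {FF : Filter F} (f : T -> 'M[K]_(m, n)) (g : T -> 'M[K]_(n, p))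
    (M : 'M[K]_(m, n)) (N : 'M[K]_(n, p)) :
  f @ F --> M -> g @ F --> N -> f t *m g t @[t --> F] --> M *m N.
Proof.
move=> fM gN; apply: cvg_mx => i j; rewrite mxE.
under eq_fun do rewrite mxE.
by apply: cvg_sum => k; apply: cvgM; exact: cvg_mx_coord.
Qed.

(** * Topology of the complex numbers *)

Section complex_topology.
Variable R : realType.
Implicit Types z : R[i].

Lemma normc_normr z : (normc z)%:C%C = `|z|.
Proof. by case: z. Qed.

Lemma normc_ge0 z : 0 <= normc z.
Proof. by case: z => a b; exact: sqrtr_ge0. Qed.

Lemma normc_eq0 z : (normc z == 0) = (z == 0).
Proof. by rewrite -(inj_eq (@complexI _)) normc_normr normr_eq0. Qed.


Lemma normcR (x : R) : normc x%:C%C = `|x|.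
Proof. by apply: complexI; rewrite normc_normr normc_def/= expr0n addr0 sqrtr_sqr. Qed.

Lemma complexC_continuous : continuous (fun x : R => x%:C%C).
Proof.
move=> x; apply/cvgrPdist_lt => e; rewrite ltcE/= => /andP[/eqP e0 e1].
(* In [R[i]], the relation [0 < e] forces [e] to be real. *)
have -> : e = (complex.Re e)%:C%C by case: e e0 {e1} => a b /= ->.
near=> y.
rewrite -rmorphB/= -normc_normr normcR ltcR; near: y.
by apply: cvgr_dist_lt.
Unshelve. all: by end_near. Qed.

Lemma ler_dist_normc z w : `|normc z - normc w| <= normc (z - w).
Proof. by rewrite -lecR -normcR !normc_normr rmorphB/= !normc_normr ler_dist_dist. Qed.

Lemma normc_continuous : continuous (fun z : R[i] => normc z).
Proof.
move=> z; apply/(@cvgrPdist_lt _ R _ (nbhs z)) => e e0.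
have : nbhs z (ball z e%:C%C) by apply: nbhsx_ballx; rewrite ltcR.
apply: filterS => w zw.
by apply: (le_lt_trans (ler_dist_normc _ _)); rewrite -ltcR normc_normr.
Qed.

(** The disc is a closed part of the image of the compact square [[-M, M]^2] under
    [(a, b) |-> a + i b]. *)
Lemma closed_disc_compact (M : R) : compact [set z : R[i] | normc z <= M].
Proof.
pose f (p : R * R) : R[i] := p.1%:C%C + 'i%C * p.2%:C%C.
have cf : continuous f.
  move=> p; apply: cvgD.
    apply: (@cvg_comp _ _ _ fst (fun x : R => x%:C%C) _ _ _ cvg_fst).
    exact: complexC_continuous.
  apply: cvgMr.
  apply: (@cvg_comp _ _ _ snd (fun x : R => x%:C%C) _ _ _ cvg_snd).
  exact: complexC_continuous.
have cI : compact (f @` (`[- M, M] `*` `[- M, M])).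
  apply: continuous_compact; first exact: continuous_subspaceT.
  by apply: compact_setX; exact: segment_compact.
apply: (subclosed_compact _ cI).
  exact: (closed_comp (fun z _ => @normc_continuous z) (@closed_le _ M)).
move=> z /= zM; exists (complex.Re z, complex.Im z).
  case: z zM => a b /= zM.
  split; rewrite /= in_itv/= -ler_norml.
    by apply: le_trans zM; rewrite -sqrtr_sqr ler_wsqrtr// lerDl sqr_ge0.
  by apply: le_trans zM; rewrite -sqrtr_sqr ler_wsqrtr// lerDr sqr_ge0.
rewrite /f/=; case: z {zM} => a b; apply/eqP; rewrite eq_complex/=.
by apply/andP; split; apply/eqP; ring.
Qed.

(** * The l1 norm of complex vectors *)

Section norm1.
Variable n : nat.
Implicit Types v : 'rV[R[i]]_n.

(** The values lie in [R], whose order is total, while those of the norm [|_|] lie in [R[i]]. *)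
Definition norm1 v : R := \sum_i normc (v 0 i).

Lemma norm1_eq0 v : (norm1 v == 0) = (v == 0).
Proof.
rewrite psumr_eq0; last by move=> i _; exact: normc_ge0.
apply/allP/eqP => [v0|-> i _]; last by rewrite mxE normc_eq0 eqxx.
apply/rowP => i; apply/eqP.
by rewrite mxE -normc_eq0 (implyP (v0 i (mem_index_enum i))).
Qed.

Lemma norm1Z c v : norm1 (c *: v) = normc c * norm1 v.
Proof.
rewrite /norm1 mulr_sumr; apply: eq_bigr => i _.
by rewrite mxE ComplexField.Normc.normcM.
Qed.

Lemma norm1_ge0 v : 0 <= norm1 v.
Proof. by apply: sumr_ge0 => i _; exact: normc_ge0. Qed.

Lemma normc_coord_continuous i : continuous (fun v => normc (v 0 i)).
Proof.
move=> v; apply: (@cvg_comp _ _ _ (fun v => v 0 i) normc);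
  last exact: normc_continuous.
exact: coord_continuous.
Qed.

Lemma norm1_continuous : continuous norm1.
Proof.
move=> v; apply: (@cvg_sum R _ 'I_n _ (nbhs v)) => i.
exact: normc_coord_continuous.
Qed.

(** The ball is a closed part of a product of compact discs. *)
Lemma norm1_ball_compact (M : R) : compact [set v | norm1 v <= M].
Proof.
apply: (subclosed_compact _ (rV_compact (fun=> @closed_disc_compact M))).
  exact: (closed_comp (fun v _ => @norm1_continuous v) (@closed_le _ M)).
move=> v /= v1 i; apply: le_trans v1; rewrite /norm1 (bigD1 i)//= lerDl.
by apply: sumr_ge0 => j _; exact: normc_ge0.
Qed.

Lemma normcB z w : normc (z - w) = normc (w - z).
Proof. by apply: complexI; rewrite !normc_normr distrC. Qed.

Lemma ler_norm1D v w : norm1 (v + w) <= norm1 v + norm1 w.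
Proof.
rewrite /norm1 -big_split/=; apply: ler_sum => i _.
by rewrite mxE -lecR rmorphD/= !normc_normr ler_normD.
Qed.

Lemma norm1B v w : norm1 (v - w) = norm1 (w - v).
Proof. by apply: eq_bigr => i _; rewrite !mxE normcB. Qed.

(** [norm1] bounds every coordinate, so its balls lie in the entrywise balls; conversely it is
    continuous. *)
Lemma nbhs_norm1 v (A : set 'rV[R[i]]_n) : nbhs v A <->
  exists2 e, 0 < e & forall w, norm1 (w - v) < e -> A w.
Proof.
split.
  move=> /nbhs_ballP[e]; rewrite /= ltcE/= => /andP[/eqP e0 e1] vA.
  have Ee : e = (complex.Re e)%:C%C by case: e e0 {e1 vA} => a b /= ->.
  exists (complex.Re e) => // w vw; apply: vA; split; first by rewrite Ee ltcR.
  move=> i j; rewrite ord1 /ball/= Ee -normc_normr ltcR.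
  apply: le_lt_trans vw; rewrite /norm1 (bigD1 j)//= !mxE normcB lerDl.
  by apply: sumr_ge0 => k _; exact: normc_ge0.
move=> [e e0 vA].
have : nbhs (norm1 (v - v)) [set x | x < e].
  by apply: lt_nbhsl; rewrite subrr (eqP (_ : norm1 0 == 0)) ?norm1_eq0.
have /(_ v) : continuous (fun w : 'rV[R[i]]_n => norm1 (w - v)).
  move=> w.
  apply: (@continuous_comp _ _ _ (fun w : 'rV[R[i]]_n => w - v) norm1).
    by apply: (@cvgB _ _ _ (nbhs w)); [exact: cvg_id|exact: cvg_cst].
  exact: norm1_continuous.
move=> cv nv; apply: (@filterS _ (nbhs v) _ _ _ vA); exact: cv nv.
Qed.

End norm1.
End complex_topology.

(** * Nested cones *)

Section trapping.
Variables (R : realType) (n : nat).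
Implicit Types (A P D : 'M[R[i]]_n.+1) (u v w d : 'rV[R[i]]_n.+1).
Implicit Types V C : set 'rV[R[i]]_n.+1.

(* A cone over a closed subset of the projective space is closed only in
   [C^(n+1) \ 0], so [C] may contain 0 and [attracts] ignores it. *)
Record nested_cones V C : Prop := NestedCones {
  nested_open : open V;
  nested_closed : closed C;
  nested_sub : V `<=` C;
  nested_openZ : forall c v, c != 0 -> V v -> V (c *: v);
  nested_closedZ : forall c v, c != 0 -> C v -> C (c *: v);
  nested_neq0 : forall v, V v -> v != 0;
  nested_nonempty : V !=set0;
  nested_proper : exists2 v, v != 0 & ~ V v }.

(** For the cones over [W] and over its closure, this says that gamma maps the closure of [W] into
    [W]. *)
Definition attracts A V C := forall v, v != 0 -> C v -> V (v *m A).

Lemma near_attracts T (F : set_system T) {FF : Filter F}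
    (f : T -> 'M[R[i]]_n.+1) A V C :
  nested_cones V C -> attracts A V C -> f @ F --> A ->
  \forall t \near F, attracts (f t) V C.
Proof.
move=> VC AVC fA.
have cK : compact (C `&` [set v | norm1 v = 1]).
  apply: (subclosed_compact _ (@norm1_ball_compact R n.+1 1)).
    apply: closedI; first exact: nested_closed VC.
    exact: (closed_comp (fun v _ => @norm1_continuous R n.+1 v) (@closed_eq _ 1)).
  by move=> v [_ /= ->].
(* Compactness: a condition that holds for all vectors near each [v] and for [t] far along [F] holds
   eventually for all [v] of the compact set at once. *)
have : \forall t \near F, C `&` [set v | norm1 v = 1] `<=` (fun v => V (v *m f t)).
  apply: (proj1 (compact_near_coveringP _) cK _ _
    (fun t v => V (v *m f t))) => v [Cv v1].
  have : (p.1 *m f p.2) @[p --> (nbhs v, F)] --> v *m A.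
    apply: cvg_mulmx; first exact: cvg_fst.
    exact: (@cvg_comp _ _ _ snd f _ _ _ cvg_snd fA).
  apply; apply: open_nbhs_nbhs; split; first exact: nested_open VC.
  apply: AVC => //; apply: contra_eq_neq v1 => ->.
  by rewrite (eqP (_ : norm1 0 == 0)) ?norm1_eq0// eq_sym oner_eq0.
apply: filterS => t Kt v v0 Cv.
(* Both cones are invariant under nonzero scalars, so [v] may be divided by its norm. *)
have c0 : (norm1 v)%:C%C != 0.
  by rewrite -(rmorph0 (real_complex R)) (inj_eq (@complexI _)) norm1_eq0.
rewrite -[v](scalerKV c0) -scalemxAl; apply: (nested_openZ VC) => //.
apply: Kt; split; first by apply: (nested_closedZ VC) => //; rewrite invr_eq0.
rewrite /= norm1Z ComplexField.Normc.normcV normcR ger0_norm ?norm1_ge0// mulVf//.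
by rewrite norm1_eq0.
Qed.

Lemma nested_cones_conj P V C : P \in unitmx -> nested_cones V C ->
  nested_cones [set v | V (v *m P)] [set v | C (v *m P)].
Proof.
move=> uP VC.
have cP : continuous (fun v => v *m P).
  move=> v; apply: (@cvg_mulmx _ _ _ _ _ (nbhs v)); first exact: cvg_id.
  exact: cvg_cst.
split.
- by apply: open_comp => [v _|]; [exact: cP|exact: nested_open VC].
- by apply: closed_comp => [v _|]; [exact: cP|exact: nested_closed VC].
- by move=> v; exact: (nested_sub VC).
- by move=> c v c0 /=; rewrite -scalemxAl; exact: (nested_openZ VC).
- by move=> c v c0 /=; rewrite -scalemxAl; exact: (nested_closedZ VC).
- by move=> v /(nested_neq0 VC); apply: contra_neq => ->; rewrite mul0mx.
- have [v Vv] := nested_nonempty VC.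
  by exists (v *m invmx P); rewrite /= mulmxKV.
- have [v v0 Vv] := nested_proper VC.
  exists (v *m invmx P); last by rewrite /= mulmxKV.
  by apply: contra_neq v0 => /(congr1 (mulmx^~ P)); rewrite mulmxKV// mul0mx.
Qed.

(** Since [conjmx P A] is [P *m A *m invmx P], the map [v |-> v *m P] turns its action into that of
    [A]. *)
Lemma attracts_conj P A V C : P \in unitmx -> attracts A V C ->
  attracts (conjmx P A) [set v | V (v *m P)] [set v | C (v *m P)].
Proof.
move=> uP AVC v v0 /= Cv; rewrite conjumx// !mulmxA mulmxKV//; apply: AVC => //.
by apply: contra_neq v0 => /(congr1 (mulmx^~ (invmx P))); rewrite mulmxK// mul0mx.
Qed.

Lemma attractsZ c A V C : c != 0 -> nested_cones V C -> attracts A V C ->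
  attracts (c *: A) V C.
Proof.
move=> c0 VC AVC v v0 Cv; rewrite -scalemxAr; apply: (nested_openZ VC) => //.
exact: AVC.
Qed.

(** Otherwise [V] and [C] agree away from 0. On a real line that avoids 0 and joins [u] in [V] to
    [w] outside [V], they would then cut out the same set, which is open, closed, nonempty and
    proper. *)
Lemma nested_cones_gap V C : nested_cones V C ->
  exists v, [/\ v != 0, C v & ~ V v].
Proof.
move=> VC; apply: contrapT => noV.
have CV v : v != 0 -> C v -> V v.
  by move=> v0 Cv; apply: contrapT => Vv; apply: noV; exists v.
have [u Vu] := nested_nonempty VC; have [w w0 Vw] := nested_proper VC.
pose f (t : R) : 'rV[R[i]]_n.+1 := u + t%:C%C *: (w - u).
(* At [t = 0] the point is [u], which is nonzero; a zero at another [t] would make [w] a multiple of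
   [u], hence a point of [V]. *)
have f0 t : f t != 0.
  apply/eqP => ft0.
  have [t0|t0] := eqVneq t 0.
    move: ft0; rewrite /f t0 scale0r addr0 => u0.
    by move: (nested_neq0 VC Vu); rewrite u0 eqxx.
  have ct0 : t%:C%C != 0 :> R[i].
    by rewrite -(rmorph0 (real_complex R)) (inj_eq (@complexI _)).
  have wE : w = (t%:C%C^-1 * (t%:C%C - 1)) *: u.
    apply: (scalerI ct0); rewrite scalerA mulVKf//.
    apply/eqP; rewrite -subr_eq0 -ft0 /f scalerBr scalerBl scale1r; apply/eqP.
    by rewrite opprB addrCA addrA.
  apply: Vw; rewrite wE; apply: (nested_openZ VC) => //.
  by apply: contra_neq w0 => c0; rewrite wE c0 scale0r.
have cf : continuous f.
  move=> t; apply: (@cvgD _ _ _ (nbhs t)); first exact: cvg_cst.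
  by apply: (@cvgZr_tmp _ _ _ (nbhs t)); exact: complexC_continuous.
have cR : connected [set: R] by apply/connected_intervalP.
have fV : f @^-1` V = f @^-1` C.
  by apply/seteqP; split => t /=; [exact: (nested_sub VC)|exact: CV].
have : f @^-1` V = setT.
  apply: cR.
  - by exists 0; rewrite /= /f scale0r addr0.
  - exists (f @^-1` V); last by rewrite setTI.
    by apply: open_comp => [t _|]; [exact: cf|exact: nested_open VC].
  - exists (f @^-1` C); last by rewrite setTI.
    by apply: closed_comp => [t _|]; [exact: cf|exact: nested_closed VC].
move=> /seteqP[_ /(_ 1 I)] /=; rewrite /f scale1r addrC subrK; exact: Vw.
Qed.
End trapping.

(** * Diagonal matrices *)

Section diagonal.
Variables (R : realType) (n : nat).
Implicit Types (v d : 'rV[R[i]]_n.+1) (V C : set 'rV[R[i]]_n.+1).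

Lemma mulmx_diagE v d i : (v *m diag_mx d) 0 i = v 0 i * d 0 i.
Proof. by rewrite mul_mx_diag mxE. Qed.

Lemma norm1_mul_unitary d : (forall i, normc (d 0 i) = 1) ->
  forall m v, norm1 (v *m diag_mx d ^+ m) = norm1 v.
Proof.
move=> d1; elim=> [|m IH] v; first by rewrite expr0 mulmx1.
rewrite exprS -mulmxE mulmxA IH; apply: eq_bigr => i _.
by rewrite mulmx_diagE ComplexField.Normc.normcM d1 mulr1.
Qed.

(** The orbit stays in a compact ball, so its points at two times [m < m'] are within [e / 2] of a
    cluster point. The isometry [diag_mx d ^+ m] is then cancelled, which leaves the return time
    [m' - m]. It is positive, so that one step can be split off from it later. *)
Lemma recurrent_unitary d : (forall i, normc (d 0 i) = 1) ->
  forall v e, 0 < e -> exists m, norm1 (v *m diag_mx d ^+ m.+1 - v) < e.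
Proof.
move=> d1 v e e0; pose u m := v *m diag_mx d ^+ m.
have [|p [_ clp]] := @norm1_ball_compact R n.+1 (norm1 v) (u @ \oo) _.
  by exists 0%N => // m _; rewrite /= norm1_mul_unitary.
have pB : nbhs p [set z | norm1 (z - p) < e / 2].
  by apply/nbhs_norm1; exists (e / 2) => //; rewrite divr_gt0.
have [z0 [[m _ <-] mp]] : u @` setT `&` [set z | norm1 (z - p) < e / 2] !=set0.
  by apply: clp => //; exists 0%N => // m _; exists m.
have [z1 [[m' mm' <-] m'p]] :
    u @` [set k | (m < k)%N] `&` [set z | norm1 (z - p) < e / 2] !=set0.
  by apply: clp => //; exists m.+1 => // k /= mk; exists k.
exists (m' - m).-1; rewrite prednK ?subn_gt0//.
rewrite -(norm1_mul_unitary d1 m) mulmxBl -mulmxA mulmxE -exprD.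
rewrite subnK ?(ltnW mm')// (splitr e).
rewrite -[X in norm1 X](subrKA p); apply: le_lt_trans (ler_norm1D _ _) _.
by apply: ltrD => //; rewrite norm1B.
Qed.

Lemma unitary_not_attracts d V C : (forall i, normc (d 0 i) = 1) ->
  nested_cones V C -> ~ attracts (diag_mx d) V C.
Proof.
move=> d1 VC dVC; have [x [x0 Cx Vx]] := nested_cones_gap VC.
have d0 i : d 0 i != 0 by rewrite -normc_eq0 d1 oner_eq0.
pose y := \row_i (x 0 i / d 0 i).
have yx : y *m diag_mx d = x.
  by apply/rowP => i; rewrite mulmx_diagE mxE divfK.
have y0 : y != 0 by apply: contra_neq x0 => y0; rewrite -yx y0 mul0mx.
have Cy : ~ C y by move=> Cy; apply: Vx; rewrite -yx; exact: dVC.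
have CxD m : C (x *m diag_mx d ^+ m).
  elim: m => [|m IH]; first by rewrite expr0 mulmx1.
  rewrite exprSr -mulmxE mulmxA; apply: (nested_sub VC); apply: dVC => //.
  by rewrite -norm1_eq0 norm1_mul_unitary// norm1_eq0.
have /nbhs_norm1[e e0 yC] : nbhs y (~` C).
  by apply: open_nbhs_nbhs; split => //; apply: closed_openC; exact: nested_closed VC.
(* The returning point [y *m diag_mx d ^+ m.+1] is [x *m diag_mx d ^+ m]: it lies in [C], and also
   in a ball around [y] disjoint from [C]. *)
have [m ym] := recurrent_unitary d1 y e0.
by apply: (yC _ ym); rewrite exprS -mulmxE mulmxA yx.
Qed.

(** The sign [s i] is that of [normc (d 0 i) - r] where this is nonzero, so the matrix turns [h v]
    into [r * h v] plus a sum of nonnegative terms. If that sum vanishes, [v] is supported where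
    [normc (d 0 i) = r]; there the sign is -1, so [h v = - norm1 v], and [h v >= 0] forces
    [v = 0]. *)
Lemma split_attracts d i0 j0 : normc (d 0 j0) < normc (d 0 i0) ->
  exists V C, nested_cones V C /\ attracts (diag_mx d) V C.
Proof.
set r := normc (d 0 j0) => ri0.
(* The strict inequality gives sign -1 to the moduli equal to [r], in particular at [j0]; hence the
   open cone is proper. *)
pose s i : R := if r < normc (d 0 i) then 1 else - 1.
pose h v := \sum_i s i * normc (v 0 i).
have hc : continuous h.
  move=> v; apply: (@cvg_sum R _ 'I_n.+1 _ (nbhs v)) => i.
  by apply: (@cvgM _ _ (nbhs v)); [exact: cvg_cst|exact: normc_coord_continuous].
have hZ c v : h (c *: v) = normc c * h v.
  rewrite /h mulr_sumr; apply: eq_bigr => i _.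
  by rewrite mxE ComplexField.Normc.normcM mulrCA.
have h0 : h 0 = 0 by rewrite -(scale0r 0) hZ ComplexField.Normc.normc0 mul0r.
have c_gt0 (c : R[i]) : c != 0 -> 0 < normc c.
  by move=> c0; rewrite lt_neqAle normc_ge0 eq_sym normc_eq0 c0.
have hdelta i : h (delta_mx 0 i) = s i.
  rewrite /h (bigD1 i)//= mxE !eqxx ComplexField.Normc.normc1 mulr1.
  rewrite big1 ?addr0// => j ji.
  by rewrite mxE eqxx (negPf ji) ComplexField.Normc.normc0 mulr0.
exists [set v | 0 < h v], [set v | 0 <= h v]; split.
  split.
  - exact: (open_comp (fun v _ => hc v) (@open_gt _ 0)).
  - exact: (closed_comp (fun v _ => hc v) (@closed_ge _ 0)).
  - by move=> v; exact: ltW.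
  - by move=> c v c0 /= hv; rewrite hZ mulr_gt0// c_gt0.
  - by move=> c v c0 /= hv; rewrite hZ mulr_ge0// normc_ge0.
  - by move=> v /=; apply: contraTneq => ->; rewrite h0 ltxx.
  - by exists (delta_mx 0 i0); rewrite /= hdelta /s ri0.
  - exists (delta_mx 0 j0); last by rewrite /= hdelta /s ltxx ltr0N1.
    apply/eqP => /rowP/(_ j0); rewrite !mxE !eqxx; exact/eqP/oner_neq0.
move=> v v0 /= hv.
have hdE : h (v *m diag_mx d) =
    r * h v + \sum_i `|normc (d 0 i) - r| * normc (v 0 i).
  rewrite /h mulr_sumr -big_split/=; apply: eq_bigr => i _.
  rewrite mulmx_diagE ComplexField.Normc.normcM /s; case: ltP => rd.
    by rewrite ger0_norm ?subr_ge0 ?(ltW rd)//; ring.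
  by rewrite ler0_norm ?subr_le0//; ring.
have r0 : 0 <= r by exact: normc_ge0.
have S0 i : 0 <= `|normc (d 0 i) - r| * normc (v 0 i).
  by rewrite mulr_ge0// normc_ge0.
rewrite hdE; have [S|] := ltP 0 (\sum_i `|normc (d 0 i) - r| * normc (v 0 i)).
  by rewrite ltr_wpDl// mulr_ge0.
rewrite le_eqVlt ltNge sumr_ge0 ?orbF; last by move=> i _; exact: S0.
rewrite psumr_eq0; last by move=> i _; exact: S0.
move=> /allP Sz; exfalso.
have sv i : s i * normc (v 0 i) = - normc (v 0 i).
  have := implyP (Sz i (mem_index_enum i)) isT.
  rewrite mulf_eq0 normr_eq0 subr_eq0 /s => /orP[/eqP ->|/eqP ->].
    by rewrite ltxx mulN1r.
  by rewrite mulr0 oppr0.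
move: hv; rewrite /h; under eq_bigr do rewrite sv.
rewrite sumrN oppr_ge0 => v1.
by move: v0; rewrite -norm1_eq0 eq_le norm1_ge0 v1.
Qed.
End diagonal.

(** * Triangular matrices and perturbation *)

Lemma eigenvalue_trig (F : fieldType) n (T : 'M[F]_n) a : is_trig_mx T ->
  eigenvalue T a = [exists i, T i i == a].
Proof.
move=> trigT; rewrite eigenvalue_root_char char_poly_trig// rootE horner_prod.
rewrite prodf_seq_eq0; apply/hasP/existsP => -[k].
  by rewrite /= hornerXsubC subr_eq0 eq_sym; exists k.
by move=> Tk; exists k; rewrite ?mem_index_enum//= hornerXsubC subr_eq0 eq_sym.
Qed.

Lemma eigenvalue_conjumx (F : fieldType) n (P A : 'M[F]_n) a : P \in unitmx ->
  eigenvalue (conjmx P A) a = eigenvalue A a.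
Proof.
have sub Q B : Q \in unitmx -> eigenvalue (conjmx Q B) a -> eigenvalue B a.
  move=> uQ; have := @eigenvalue_conjmx _ _ _ Q B (stablemx_unit B uQ).
  by rewrite row_free_unit uQ => /(_ isT a).
move=> uP; apply/idP/idP; first exact: sub.
by rewrite -{1}(conjmxK A uP); apply: sub; rewrite unitmx_inv.
Qed.

(** The minimal polynomial divides the characteristic one, here a product of distinct linear
    factors. *)
Lemma trig_uniq_diagonalizable (F : fieldType) n (T : 'M[F]_n.+1) :
  is_trig_mx T -> injective (fun i => T i i) -> diagonalizable T.
Proof.
move=> trigT injT; apply/diagonalizableP; exists [seq T i i | i <- enum 'I_n.+1].
  by rewrite map_inj_uniq ?enum_uniq.
apply: dvdp_trans (mxminpoly_dvd_char _) _.
by rewrite char_poly_trig// big_map big_enum.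
Qed.

Section perturbation.
Variables (R : realType) (n : nat).
Implicit Types (A P T : 'M[R[i]]_n.+1) (V C : set 'rV[R[i]]_n.+1).

(** The link between both sides of the theorem: for invertible [A], it is equivalent to each of
    them. *)
Definition trapped A := exists V C, nested_cones V C /\ attracts A V C.

Lemma trapped_conj P A : P \in unitmx -> trapped (conjmx P A) <-> trapped A.
Proof.
have conj Q B : Q \in unitmx -> trapped B -> trapped (conjmx Q B).
  move=> uQ [V [C [VC BVC]]].
  exists [set v | V (v *m Q)], [set v | C (v *m Q)].
  by split; [exact: nested_cones_conj|exact: attracts_conj].
move=> uP; split; last exact: conj.
by move=> /(conj (invmx P)); rewrite unitmx_inv conjmxK//; apply.
Qed.

Lemma trappedZ c A : c != 0 -> trapped A -> trapped (c *: A).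
Proof.
by move=> c0 [V [C [VC AVC]]]; exists V, C; split => //; exact: attractsZ.
Qed.

(* Conjugating by [diag (t ^ i)] multiplies the [(i, j)] entry by [t ^ (i - j)],
   so a triangular matrix is conjugate to arbitrarily small perturbations of its
   diagonal part. *)
Lemma trapped_trig T i0 j0 : is_trig_mx T ->
  normc (T j0 j0) < normc (T i0 i0) -> trapped T.
Proof.
move=> trigT lt_ji; pose d : 'rV[R[i]]_n.+1 := \row_i T i i.
have [V [C [VC dVC]]] : trapped (diag_mx d).
  by apply: (@split_attracts _ _ d i0 j0); rewrite !mxE.
pose t k : R[i] := (@harmonic R k)%:C%C.
have t0 k : t k != 0.
  rewrite /t -(rmorph0 (real_complex R)) (inj_eq (@complexI _)).
  by rewrite gt_eqF ?harmonic_gt0.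
pose S k : 'M[R[i]]_n.+1 := diag_mx (\row_i t k ^+ i).
have uS k : S k \in unitmx.
  rewrite unitmxE det_diag unitfE; apply/prodf_neq0 => i _.
  by rewrite mxE expf_neq0.
have SE k i j : conjmx (S k) T i j = t k ^+ i * T i j / t k ^+ j.
  have invS : invmx (S k) = diag_mx (\row_i (t k ^+ i)^-1).
    apply: (can_inj (mulKmx (uS k))); rewrite mulmxV// mulmx_diag.
    by apply/matrixP => a b; rewrite !mxE divff ?expf_neq0.
  by rewrite conjumx// invS mul_diag_mx mul_mx_diag !mxE.
have cS : (fun k => conjmx (S k) T) @ \oo --> diag_mx d.
  apply: cvg_mx => i j; rewrite !mxE.
  under eq_fun do rewrite SE.
  case: (ltngtP i j) => [ij|ji|ij].
  - have /negPf -> : i != j by rewrite -val_eqE neq_ltn ij.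
    have -> : T i j = 0 by move/is_trig_mxP: trigT; apply.
    by under eq_fun do rewrite mulr0 mul0r; exact: cvg_cst.
  - have /negPf -> : i != j by rewrite -val_eqE neq_ltn ji orbT.
    have E k : t k ^+ i * T i j / t k ^+ j =
        (@harmonic R k ^+ (i - j))%:C%C * T i j.
      rewrite rmorphXn/= -/(t k) -{1}(subnK (ltnW ji))
        exprD mulrAC mulfK ?expf_neq0//.
    under eq_fun do rewrite E.
    (* The limit 0 is written with the power [0 ^+ (i - j)], whose exponent is positive, to match
       the continuity of powers. *)
    have -> : T i i *+ false = ((0 : R) ^+ (i - j))%:C%C * T i j.
      by rewrite expr0n subn_eq0 leqNgt ji mul0r.
    apply: cvgM; last exact: cvg_cst.
    apply: (@cvg_comp _ _ _ (fun k => @harmonic R k ^+ (i - j))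
      (fun x : R => x%:C%C)); last exact: complexC_continuous.
    apply: (@cvg_comp _ _ _ (@harmonic R) (fun x : R => x ^+ (i - j)));
      last exact: exprn_continuous.
    exact: cvg_harmonic.
  - have {ij} -> : i = j by exact: val_inj.
    under eq_fun => k do rewrite mulrAC mulfV ?expf_neq0// mul1r.
    by rewrite eqxx; exact: cvg_cst.
have [k _ /(_ k (leqnn k)) kVC] := near_attracts VC dVC cS.
by apply/(trapped_conj _ (uS k)); exists V, C.
Qed.

(** * Making the diagonal entries distinct *)

Lemma near_not_root (F : fieldType) (w : nat -> F) (p : {poly F}) :
  injective w -> p != 0 -> \forall k \near \oo, ~~ root p (w k).
Proof.
move=> injw p0; apply: contrapT => np.
(* If [p] vanished at [w k] for arbitrarily large [k], there would be lists of such distinct [k] of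
   every length, hence too many roots. Each new index is sought beyond the maximum of the list. *)
have roots m : exists2 s : seq nat, size s = m &
    uniq s && all (fun k => root p (w k)) s.
  elim: m => [|m [s sm /andP[us ps]]]; first by exists [::].
  apply: contrapT => ns; apply: np; exists (\max_(k <- s) k).+1 => // k /= sk.
  apply: contrapT => /negP; rewrite negbK => pk; apply: ns.
  exists (k :: s); rewrite /= ?sm// us ps pk !andbT.
  by apply/negP => ks; move: sk; rewrite ltnNge leq_bigmax_seq.
have [s ss /andP[us ps]] := roots (size p).
have := max_poly_roots p0 (rs := map w s).
by rewrite all_map map_inj_uniq// size_map ss ltnn => /(_ ps us).
Qed.

(* The Cayley transform of [1 / (k + 1)]. *)
Definition unit_seq k : R[i] :=
  (1 + 'i%C * (@harmonic R k)%:C%C) / (1 + 'i%C * (@harmonic R k)%:C%C)^*%C.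

Lemma unit_seq_num_neq0 k : 1 + 'i%C * (@harmonic R k)%:C%C != 0.
Proof.
rewrite eq_complex/= negb_and.
by rewrite mul0r mulr0 subrr addr0 oner_eq0.
Qed.

Lemma normc_unit_seq k : normc (unit_seq k) = 1.
Proof.
apply: complexI; rewrite normc_normr normrM normfV normcJ divff//.
by rewrite normr_eq0 unit_seq_num_neq0.
Qed.

Lemma unit_seq_inj : injective unit_seq.
Proof.
move=> k l; rewrite /unit_seq => /eqP.
rewrite eqr_div ?conjc_eq0 ?unit_seq_num_neq0// => /eqP kl.
have : @harmonic R k = harmonic l.
  move: kl; move: (harmonic k) (harmonic l) => a b /eqP.
  (* The equality of imaginary parts amounts to [a - b = b - a]. *)
  rewrite eq_complex/= => /andP[_ /eqP].
  lra.
move=> /invr_inj/eqP; rewrite eqr_nat => /eqP[]//.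
Qed.

Lemma cvg_unit_seq : unit_seq @ \oo --> (1 : R[i]).
Proof.
have t0 : (@harmonic R k)%:C%C @[k --> \oo] --> (0%:C%C : R[i]).
  apply: (@cvg_comp _ _ _ (@harmonic R) (fun x : R => x%:C%C));
    last exact: complexC_continuous.
  exact: cvg_harmonic.
(* This serves for the numerator, with [a] equal to ['i], and for its conjugate, with [- 'i]. *)
have num (a : R[i]) : 1 + a * (@harmonic R k)%:C%C @[k --> \oo] --> (1 : R[i]).
  rewrite -[X in _ --> X]addr0 -[X in _ + X](mulr0 a).
  by apply: cvgD; [exact: cvg_cst|apply: cvgM; [exact: cvg_cst|exact: t0]].
rewrite -[X in _ --> X]divr1; apply: cvgM; first exact: num.
apply: cvgV; first exact: oner_neq0.
have E k : (1 + 'i%C * (@harmonic R k)%:C%C)^*%C =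
    1 + - 'i%C * (@harmonic R k)%:C%C.
  apply/eqP; rewrite eq_complex/=; apply/andP; split; apply/eqP;
    by rewrite ?(mul0r,mulr0,oppr0,subr0,addr0,add0r,mul1r,mulN1r,mulNr).
under eq_fun do rewrite E.
exact: num.
Qed.

(** The [i]-th diagonal entry is multiplied by [unit_seq k ^+ i], which has modulus 1 and tends to
    1. For large [k] the same cones still work and the entries are distinct. *)
Lemma trapped_perturb T : is_trig_mx T -> trapped T ->
  (forall i, normc (T i i) = 1) ->
  exists T', [/\ is_trig_mx T', trapped T', forall i, normc (T' i i) = 1 &
    injective (fun i => T' i i)].
Proof.
move=> trigT [V [C [VC TVC]]] T1.
pose f k := T + diag_mx (\row_i (T i i * (unit_seq k ^+ i - 1))).
have fii k i : f k i i = T i i * unit_seq k ^+ i.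
  by rewrite !mxE eqxx mulr1n mulrBr mulr1 addrC subrK.
have cf : f @ \oo --> T.
  rewrite -[X in _ --> X]addr0; apply: cvg_mx => i j; rewrite !mxE.
  under eq_fun do rewrite !mxE.
  apply: cvgD; first exact: cvg_cst.
  case: (i == j); last exact: cvg_cst.
  suff : T i i * (unit_seq k ^+ i - 1) @[k --> \oo] --> (0 : R[i]) by [].
  rewrite [X in _ --> X](_ : _ = T i i * (1 ^+ i - 1));
    last by rewrite expr1n subrr mulr0.
  apply: cvgM; first exact: cvg_cst.
  apply: cvgD; last exact: cvg_cst.
  elim: (nat_of_ord i) => [|m IH]; first by rewrite expr0; exact: cvg_cst.
  under eq_fun do rewrite exprS.
  by rewrite exprS; apply: cvgM; [exact: cvg_unit_seq|exact: IH].
have inj_f : \forall k \near \oo,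
    forall i j : 'I_n.+1, (i < j)%N -> f k i i != f k j j.
  apply: filter_forall => i; apply: filter_forall => j.
  have [ij|_] := ltnP i j; last by exists 0%N.
  (* Entries [i] and [j] of the diagonal coincide exactly when [unit_seq k] is a root of [p], whose
     coefficient in degree [j] is [T j j], of modulus 1. *)
  pose p := T j j *: 'X^j - T i i *: 'X^i.
  have p0 : p != 0.
    apply/eqP => /(congr1 (fun q : {poly R[i]} => q`_j)).
    rewrite coefB !coefZ !coefXn eqxx gtn_eqF// mulr0 subr0 mulr1 coef0 => Tj.
    move: (T1 j); rewrite Tj ComplexField.Normc.normc0 => /eqP.
    by rewrite eq_sym oner_eq0.
  apply: filterS (near_not_root unit_seq_inj p0) => k + _.
  by rewrite rootE !hornerE !fii subr_eq0 eq_sym.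
have [k [kVC kinj]] := filter_ex (filterI (near_attracts VC TVC cf) inj_f).
exists (f k); split; last 1 first.
- move=> i j /= /eqP fij; apply: val_inj; apply/eqP.
  case: (ltngtP i j) => // ij; first by move: fij; rewrite (negPf (kinj _ _ ij)).
  by move: fij; rewrite eq_sym (negPf (kinj _ _ ij)).
- apply/is_trig_mxP => i j ij; rewrite !mxE -val_eqE ltn_eqF// mulr0n addr0.
  by move/is_trig_mxP: trigT; apply.
- by exists V, C.
- move=> i; rewrite fii ComplexField.Normc.normcM T1 mul1r.
  elim: (nat_of_ord i) => [|m IH]; first by rewrite expr0 ComplexField.Normc.normc1.
  by rewrite exprS ComplexField.Normc.normcM IH normc_unit_seq mulr1.
Qed.

(** * Trapping and the moduli of eigenvalues *)

Lemma unitary_spectrum_not_trapped A :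
  (forall a, eigenvalue A a -> normc a = 1) -> ~ trapped A.
Proof.
move=> A1 trapA.
have [P /unitarymx_unit uP trigT] := Schur A (ltn0Sn n).
have T1 i : normc (conjmx P A i i) = 1.
  apply: A1; rewrite -(eigenvalue_conjumx _ _ uP) eigenvalue_trig//.
  by apply/existsP; exists i.
have [T' [trigT' trapT' T'1 injT']] :=
  trapped_perturb trigT (proj2 (trapped_conj A uP) trapA) T1.
have [Q uQ /similar_diagPex[D /eqP QD]] := trig_uniq_diagonalizable trigT' injT'.
have [V [C [VC DVC]]] : trapped (diag_mx D) by rewrite -QD; apply/trapped_conj.
apply: (unitary_not_attracts _ VC DVC) => i.
(* The entries of [D] are eigenvalues of [T'], hence diagonal entries of [T'], of modulus 1. *)
have : eigenvalue T' (D 0 i).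
  rewrite -(eigenvalue_conjumx _ _ uQ) QD eigenvalue_trig ?diag_mx_is_trig//.
  by apply/existsP; exists i; rewrite mxE eqxx.
by rewrite eigenvalue_trig// => /existsP[j /eqP <-].
Qed.

Lemma loxodromic_trapped A : A \in unitmx -> loxodromic A <-> trapped A.
Proof.
move=> uA; split => [loxA|trapA c detcA]; last first.
  have c0 : c != 0.
    apply/eqP => c0; move: detcA; rewrite c0 scale0r det0// => /eqP.
    by rewrite eq_sym oner_eq0.
  apply: contrapT => nl; apply: (@unitary_spectrum_not_trapped (c *: A)).
    move=> a Aa; apply: complexI; rewrite normc_normr; apply/eqP.
    by apply: contrapT => /negP a1; apply: nl; exists a.
  exact: trappedZ.
(* One lift to determinant 1 suffices for this direction. *)
pose c := n.+1.-root (\det A)^-1.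
have detcA : \det (c *: A) = 1.
  by rewrite detZ rootCK// mulVf// -unitfE -unitmxE.
have c0 : c != 0.
  by rewrite rootC_eq0// invr_eq0 -unitfE -unitmxE.
have [l [cAl l1]] := loxA c detcA.
have [P /unitarymx_unit uP trigT] := Schur (c *: A) (ltn0Sn n).
suff /trapped_conj : trapped (conjmx P (c *: A)).
  move=> /(_ uP) trapcA; rewrite -[A](scalerK c0); apply: trappedZ => //.
  by rewrite invr_eq0.
move: cAl; rewrite -(eigenvalue_conjumx _ _ uP).
set T := conjmx P (c *: A) in trigT *.
rewrite eigenvalue_trig// => /existsP[i0 /eqP Tl].
have detT : \prod_i T i i = 1.
  rewrite -det_trig// /T conjumx// !det_mulmx det_inv detcA mulr1.
  by rewrite divff// -unitfE -unitmxE.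
(* If all diagonal moduli equalled that of [l], determinant 1 would make its power [n.+1] equal to
   1, hence [l] of modulus 1. *)
have [j Tj] : exists j, normc (T j j) != normc (T i0 i0).
  apply/not_existsP => Tj; move/negP: l1; apply.
  rewrite -(@pexpr_eq1 _ _ n.+1)//; apply/eqP.
  transitivity (\prod_i `|T i i|); last by rewrite -normr_prod detT normr1.
  rewrite (eq_bigr (fun=> `|l|)); last first.
    move=> i _; rewrite -Tl -!normc_normr; move/negP: (Tj i).
    by rewrite negbK => /eqP ->.
  by rewrite prodr_const card_ord.
by have [lt_j|lt_i|/eqP] := ltgtP (normc (T j j)) (normc (T i0 i0));
  [exact: trapped_trig lt_j|exact: trapped_trig lt_i|rewrite (negPf Tj)].
Qed.
End perturbation.

(** * Cones over subsets of the projective space *)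

Section projective.
Variables (R : realType) (n : nat).
Implicit Types (A : 'M[R[i]]_n.+1) (v w : 'rV[R[i]]_n.+1) (u : punctured R n).
Implicit Types (V C : set 'rV[R[i]]_n.+1) (W : set (projective_space R n)).

Definition proj_class u : projective_space R n :=
  \pi_({eq_quot (@proportional_equiv R n)})%qT u.

Lemma proj_class_eq u u' : proj_class u = proj_class u' <->
  exists2 c, c != 0 & set_val u = c *: set_val u'.
Proof.
split.
  move=> /eqmodP/asboolP[c [c0 uu']]; by exists c.
by move=> [c c0 uu']; apply/eqmodP/asboolP; exists c.
Qed.

Lemma proj_class_repr x : proj_class (repr x) = x.
Proof. exact: reprK. Qed.

Lemma proj_class_continuous : continuous proj_class.
Proof. exact: pi_continuous. Qed.

Lemma punctured_neq0 u : set_val u != 0.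
Proof. by have := set_valP u; rewrite /nonzero_vec. Qed.

Lemma puncturedP v : v != 0 -> exists u, set_val u = v.
Proof.
move=> v0; have vP : v \in @nonzero_vec R n by rewrite inE.
by exists (exist _ v vP).
Qed.

(** Another representative of the class multiplies the image by a nonzero scalar, and the image is
    nonzero because [A] is invertible. *)
Lemma proj_act_class A u u' : A \in unitmx ->
  set_val u' = set_val u *m A -> proj_act A (proj_class u) = proj_class u'.
Proof.
move=> uA uu'.
have [c c0 cE] :
    exists2 c, c != 0 & set_val (repr (proj_class u)) = c *: set_val u.
  by apply/proj_class_eq; rewrite proj_class_repr.
apply/proj_class_eq; exists c => //.
rewrite set_valE insubdK -?set_valE ?cE -?scalemxAl ?uu'//.
by rewrite inE /nonzero_vec /= scaler_eq0 negb_or c0 -uu' punctured_neq0.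
Qed.

Definition cone_of W : set 'rV[R[i]]_n.+1 :=
  [set v | exists2 u, set_val u = v & W (proj_class u)].

Lemma cone_ofE W u : cone_of W (set_val u) <-> W (proj_class u).
Proof.
split=> [[u' uu' Wu']|Wu]; last by exists u.
by have <- : proj_class u' = proj_class u
  by apply/proj_class_eq; exists 1; rewrite ?oner_neq0 ?scale1r.
Qed.

Lemma cone_of_neq0 W v : cone_of W v -> v != 0.
Proof. by move=> [u <- _]; exact: punctured_neq0. Qed.

Lemma cone_ofZ W c v : c != 0 -> cone_of W v -> cone_of W (c *: v).
Proof.
move=> c0 [u <- Wu].
have [u' uu'] : exists u', set_val u' = c *: set_val u.
  by apply: puncturedP; rewrite scaler_eq0 negb_or c0 punctured_neq0.
rewrite -uu'; apply/cone_ofE.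
by have -> : proj_class u' = proj_class u by apply/proj_class_eq; exists c.
Qed.

Lemma open_cone_of W : open W -> open (cone_of W).
Proof.
move=> oW.
have /continuousP/(_ _ oW)[B oB BW] := proj_class_continuous.
(* The preimage of [W] is the trace of an open [B] on the nonzero vectors; removing 0 from [B]
   leaves an open set of the whole space. *)
have -> : cone_of W = B `&` [set v | 0 < norm1 v].
  apply/seteqP; split => [v [u <- Wu]|v [Bv]] /=.
    split; first by have : (set_val @^-1` B) u by rewrite BW.
    by rewrite lt_neqAle norm1_ge0 eq_sym norm1_eq0 punctured_neq0.
  rewrite lt_neqAle norm1_ge0 eq_sym norm1_eq0 andbT => /puncturedP[u uv].
  exists u => //; have : (set_val @^-1` B) u by rewrite /= uv.
  by rewrite BW.
apply: openI => //.
exact: (open_comp (fun v _ => @norm1_continuous R n.+1 v) (@open_gt _ 0)).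
Qed.

(** Tested on the chosen representative; for scale-invariant [V] any other gives the same answer. *)
Definition class_of V : set (projective_space R n) :=
  [set x | V (set_val (repr x))].

Lemma class_ofE V u : (forall c v, c != 0 -> V v -> V (c *: v)) ->
  class_of V (proj_class u) <-> V (set_val u).
Proof.
move=> VZ; rewrite /class_of /=.
have [c c0 cE] :
    exists2 c, c != 0 & set_val (repr (proj_class u)) = c *: set_val u.
  by apply/proj_class_eq; rewrite proj_class_repr.
rewrite cE; split; last exact: VZ.
by move=> /(VZ c^-1); rewrite invr_eq0 scalerA mulVf// scale1r; apply.
Qed.

Lemma open_class_of V : (forall c v, c != 0 -> V v -> V (c *: v)) ->
  open V -> open (class_of V).
Proof.
move=> VZ oV.
(* This is openness in the quotient topology; the preimage is the trace of [V] on the nonzero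
   vectors. *)
suff : open (proj_class @^-1` class_of V) by [].
exists V => //; apply/seteqP; split => u Vu.
  exact/(class_ofE u VZ).
exact/(class_ofE u VZ).
Qed.

Lemma trapped_projective A : A \in unitmx -> trapped A <->
  exists W, [/\ open W, W !=set0, W != setT &
    @proj_act R n A @` closure W `<=` W].
Proof.
move=> uA; have A0 v : v != 0 -> v *m A != 0.
  by apply: contra_neq => /(congr1 (mulmx^~ (invmx A))); rewrite mulmxK// mul0mx.
split=> [[V [C [VC AVC]]]|[W [oW [x Wx] WT AW]]].
  have VZ := nested_openZ VC; have CZ := nested_closedZ VC.
  exists (class_of V); split.
  - by apply: open_class_of => //; exact: nested_open VC.
  - have [v Vv] := nested_nonempty VC.
    have [u uv] := puncturedP (nested_neq0 VC Vv).
    by exists (proj_class u); apply/(class_ofE u VZ); rewrite uv.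
  - have [v v0 Vv] := nested_proper VC; have [u uv] := puncturedP v0.
    apply/eqP => /seteqP[_ /(_ (proj_class u) I)] /(class_ofE u VZ).
    by rewrite uv.
  - move=> _ [x xV <-].
    (* The classes of [C] form a closed set containing those of [V], hence also their closure. *)
    have {xV} : class_of C x.
      have clC : closed (class_of C).
        rewrite -[class_of C]setCK; apply: open_closedC.
        apply: (@open_class_of (~` C)).
          move=> c v c0 + Cv; apply; rewrite -[v](scalerK c0).
          by apply: CZ; rewrite ?invr_eq0.
        by apply: closed_openC; exact: nested_closed VC.
      rewrite ((closure_id _).1 clC).
      by apply: closure_subset xV => y; exact: (nested_sub VC).
    rewrite /class_of /= -{2}[x]proj_class_repr => Cx.
    have [u uE] := puncturedP (A0 _ (punctured_neq0 (repr x))).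
    rewrite (proj_act_class uA uE); apply/(class_ofE u VZ); rewrite uE.
    by apply: AVC => //; exact: punctured_neq0.
(* The second cone is the complement of an open cone, hence closed in the whole space; it consists
   of 0 and the cone over the closure of [W]. *)
exists (cone_of W), (~` cone_of (~` closure W)); split.
  split.
  - exact: open_cone_of.
  - apply: open_closedC; apply: open_cone_of; apply: closed_openC.
    exact: closed_closure.
  - move=> _ [u <- Wu] /cone_ofE; apply; exact: subset_closure.
  - by move=> c v; exact: cone_ofZ.
  - move=> c v c0 + Wv; apply; rewrite -[v](scalerK c0).
    by apply: cone_ofZ; rewrite ?invr_eq0.
  - by move=> v; exact: cone_of_neq0.
  - by exists (set_val (repr x)); apply/cone_ofE; rewrite proj_class_repr.
  - have [y Wy] : exists y, ~ W y.
      apply: contrapT => nW; move/eqP: WT; apply; apply/seteqP; split => // y _.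
      by apply: contrapT => Wy; apply: nW; exists y.
    exists (set_val (repr y)); first exact: punctured_neq0.
    by rewrite cone_ofE proj_class_repr.
move=> v v0 Wv; have [u uv] := puncturedP v0; have [u' uE] := puncturedP (A0 _ v0).
rewrite -uE; apply/cone_ofE; rewrite -(@proj_act_class A u)//; last by rewrite uv.
apply: AW; exists (proj_class u) => //; apply: contrapT => Wu.
by apply: Wv; rewrite -uv; apply/cone_ofE.
Qed.

End projective.

Theorem mainTheorem4 (R : realType) (n : nat) (hn : (0 < n)%N)
    (A : 'M[R[i]]_(n.+1)) (hA : A \in unitmx) :
  @loxodromic R n A <->
  exists W : set (projective_space R n),
    [/\ open W, W !=set0, W != setT &
        @proj_act R n A @` closure W `<=` W].
Proof. exact: iff_trans (loxodromic_trapped hA) (trapped_projective hA). Qed.
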